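(* Let $\mathbb{K}$ be a field of characteristic zero, and let $\mathcal{W}(2)$, $\mathcal{W}_2$ and $\mathcal{S}_2$ be, respectively, the conservative algebra of all $2$-dimensional algebras, the terminal algebra of all commutative $2$-dimensional algebras, and the algebra of all commutative $2$-dimensional algebras with trace zero multiplication, over $\mathbb{K}$. Every $2$-local $\frac12$-derivation of $\mathcal{W}(2)$, of $\mathcal{W}_2$, and of $\mathcal{S}_2$ is a $\frac12$-derivation (of the respective algebra).
   Context: Algebras are vector spaces over $\mathbb{K}$ with a bilinear multiplication; they need not be associative, commutative or unital. In all tables below the left factor is written first and all products of basis elements not listed are $0$. $\mathcal{W}(2)$ is the $8$-dimensional algebra with basis $e_1,\dots,e_8$ and multiplication: $e_1e_1=-e_1$, $e_1e_4=e_4$, $e_1e_5=-2e_5$, $e_1e_6=-e_6$, $e_1e_7=-e_7$; $e_2e_1=-e_2-e_3$, $e_2e_2=-e_4$, $e_2e_3=-e_4$, $e_2e_5=e_1-e_6-e_7$, $e_2e_6=e_2-e_8$, $e_2e_7=e_3-e_8$, $e_2e_8=e_4$; $e_5e_1=e_5$, $e_5e_2=-e_1+e_6$, $e_5e_3=-e_1+e_7$, $e_5e_4=-e_2-e_3+e_8$, $e_5e_6=-e_5$, $e_5e_7=-e_5$, $e_5e_8=-e_6-e_7$; $e_6e_2=-e_2$, $e_6e_3=-e_3$, $e_6e_4=-2e_4$, $e_6e_5=e_5$, $e_6e_8=-e_8$. $\mathcal{W}_2$ is the $6$-dimensional algebra with basis $\xi_1,\dots,\xi_6$ and multiplication: $\xi_1\xi_1=-\xi_1$,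 $\xi_1\xi_3=\xi_3$, $\xi_1\xi_4=-2\xi_4$, $\xi_1\xi_5=-\xi_5$; $\xi_2\xi_1=-\xi_2$, $\xi_2\xi_2=-2\xi_3$, $\xi_2\xi_4=\xi_1-\xi_5$, $\xi_2\xi_5=\xi_2-2\xi_6$, $\xi_2\xi_6=\xi_3$; $\xi_4\xi_1=\xi_4$, $\xi_4\xi_2=\xi_5-2\xi_1$, $\xi_4\xi_3=-\xi_2+\xi_6$, $\xi_4\xi_5=-2\xi_4$, $\xi_4\xi_6=-\xi_5$; $\xi_5\xi_2=-\xi_2$, $\xi_5\xi_3=-2\xi_3$, $\xi_5\xi_4=\xi_4$, $\xi_5\xi_6=-\xi_6$. $\mathcal{S}_2$ is the $4$-dimensional algebra with basis $z_1,\dots,z_4$ and multiplication: $z_1z_1=-z_1$, $z_1z_2=z_2$, $z_1z_3=3z_3$, $z_1z_4=-3z_4$; $z_2z_1=-2z_2$, $z_2z_2=-3z_3$, $z_2z_4=z_1$; $z_4z_1=3z_4$, $z_4z_2=-2z_1$, $z_4z_3=-z_2$. A linear map $d:\mathcal{A}\to\mathcal{A}$ on an algebra $\mathcal{A}$ is a $\frac12$-derivation if $d(xy)=\frac12\big(d(x)y+x\,d(y)\big)$ for all $x,y\in\mathcal{A}$. A (not necessarily linear) map $D:\mathcal{A}\to\mathcal{A}$ is a $2$-local $\frac12$-derivation if for all $x,y\in\mathcal{A}$ there exists a $\frac12$-derivation $d_{x,y}$ of $\mathcal{A}$ such that $D(x)=d_{x,y}(x)$ and $D(y)=d_{x,y}(y)$.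 *)

(* Defs.v *)
From mathcomp Require Import all_boot all_order all_algebra.

Set Implicit Arguments.
Unset Strict Implicit.
Unset Printing Implicit Defensive.

Import GRing.Theory.
Local Open Scope ring_scope.

Section TableAlgebra.
Variables (K : fieldType) (n : nat).

(* The basis is numbered from 1; only 1 <= i <= n.+1 is meaningful. *)
Definition basis (i : nat) : 'rV[K]_n.+1 := delta_mx 0 (inord i.-1).

(* The product on K^(n+1) extending bilinearly the 1-based table
   t i j = (basis i) * (basis j). *)
Definition table_mul (t : nat -> nat -> 'rV[K]_n.+1) (x y : 'rV[K]_n.+1) :
    'rV[K]_n.+1 :=
  \sum_(i < n.+1) \sum_(j < n.+1) (x 0 i * y 0 j) *: t i.+1 j.+1.

Lemma table_mul_linearl t y : linear (fun x => table_mul t x y).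
Proof.
move=> a u v; rewrite /table_mul scaler_sumr -big_split /=.
apply: eq_bigr => i _; rewrite scaler_sumr -big_split /=.
by apply: eq_bigr => j _; rewrite !mxE mulrDl scalerDl scalerA mulrA.
Qed.

Lemma table_mul_linearr t x : linear (table_mul t x).
Proof.
move=> a u v; rewrite /table_mul scaler_sumr -big_split /=.
apply: eq_bigr => i _; rewrite scaler_sumr -big_split /=.
apply: eq_bigr => j _.
by rewrite !mxE mulrDr scalerDl scalerA mulrCA.
Qed.

Lemma table_mul_basis t (i j : 'I_n.+1) :
  table_mul t (basis i.+1) (basis j.+1) = t i.+1 j.+1.
Proof.
rewrite /table_mul /basis /= !inord_val (bigD1 i) //= (bigD1 j) //=.
rewrite !mxE !eqxx mulr1 scale1r big1 => [|j' /negPf nj].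
  rewrite addr0 big1 ?addr0 // => i' /negPf ni; rewrite big1 // => j' _.
  by rewrite !mxE ni andbF mul0r scale0r.
by rewrite !mxE nj andbF mulr0 scale0r.
Qed.

End TableAlgebra.

Section Tables.
Variable K : fieldType.

(* W(2), the conservative algebra of all 2-dimensional algebras. *)
Local Notation e := (@basis K 7).
Definition conservative_table (i j : nat) : 'rV[K]_8 :=
  match i, j with
  | 1%N, 1%N => - e 1
  | 1%N, 4%N => e 4
  | 1%N, 5%N => - (2 *: e 5)
  | 1%N, 6%N => - e 6
  | 1%N, 7%N => - e 7
  | 2%N, 1%N => - e 2 - e 3
  | 2%N, 2%N => - e 4
  | 2%N, 3%N => - e 4
  | 2%N, 5%N => e 1 - e 6 - e 7
  | 2%N, 6%N => e 2 - e 8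
  | 2%N, 7%N => e 3 - e 8
  | 2%N, 8%N => e 4
  | 5%N, 1%N => e 5
  | 5%N, 2%N => - e 1 + e 6
  | 5%N, 3%N => - e 1 + e 7
  | 5%N, 4%N => - e 2 - e 3 + e 8
  | 5%N, 6%N => - e 5
  | 5%N, 7%N => - e 5
  | 5%N, 8%N => - e 6 - e 7
  | 6%N, 2%N => - e 2
  | 6%N, 3%N => - e 3
  | 6%N, 4%N => - (2 *: e 4)
  | 6%N, 5%N => e 5
  | 6%N, 8%N => - e 8
  | _, _ => 0
  end.

(* W_2, the terminal algebra of all commutative 2-dimensional algebras. *)
Local Notation xi := (@basis K 5).
Definition terminal_table (i j : nat) : 'rV[K]_6 :=
  match i, j with
  | 1%N, 1%N => - xi 1
  | 1%N, 3%N => xi 3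
  | 1%N, 4%N => - (2 *: xi 4)
  | 1%N, 5%N => - xi 5
  | 2%N, 1%N => - xi 2
  | 2%N, 2%N => - (2 *: xi 3)
  | 2%N, 4%N => xi 1 - xi 5
  | 2%N, 5%N => xi 2 - 2 *: xi 6
  | 2%N, 6%N => xi 3
  | 4%N, 1%N => xi 4
  | 4%N, 2%N => xi 5 - 2 *: xi 1
  | 4%N, 3%N => - xi 2 + xi 6
  | 4%N, 5%N => - (2 *: xi 4)
  | 4%N, 6%N => - xi 5
  | 5%N, 2%N => - xi 2
  | 5%N, 3%N => - (2 *: xi 3)
  | 5%N, 4%N => xi 4
  | 5%N, 6%N => - xi 6
  | _, _ => 0
  end.

(* S_2, the algebra of all commutative 2-dimensional algebras with trace zero
   multiplication. *)
Local Notation z := (@basis K 3).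
Definition trace_zero_table (i j : nat) : 'rV[K]_4 :=
  match i, j with
  | 1%N, 1%N => - z 1
  | 1%N, 2%N => z 2
  | 1%N, 3%N => 3 *: z 3
  | 1%N, 4%N => - (3 *: z 4)
  | 2%N, 1%N => - (2 *: z 2)
  | 2%N, 2%N => - (3 *: z 3)
  | 2%N, 4%N => z 1
  | 4%N, 1%N => 3 *: z 4
  | 4%N, 2%N => - (2 *: z 1)
  | 4%N, 3%N => - z 2
  | _, _ => 0
  end.

Definition conservative_mul := table_mul conservative_table.
Definition terminal_mul := table_mul terminal_table.
Definition trace_zero_mul := table_mul trace_zero_table.

End Tables.

Section HalfDerivations.
Variables (K : fieldType) (A : lmodType K) (mul : A -> A -> A).

Definition half_derivation (d : A -> A) : Prop :=
  linear d /\
  forall x y, d (mul x y) = 2^-1 *: (mul (d x) y + mul x (d y)).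

Definition two_local_half_derivation (D : A -> A) : Prop :=
  forall x y, exists d, [/\ half_derivation d, D x = d x & D y = d y].

End HalfDerivations.

(* Main.v *)
Require Import Defs.
From mathcomp Require Import all_boot all_order all_algebra.
From mathcomp Require Import ring.
Import GRing.Theory.
Local Open Scope ring_scope.

(** In each of the three algebras the only half-derivations are the
multiplications by scalars, and this forces locality to be global: a 2-local
half-derivation D then acts on any pair of points by a common scalar, and
comparing every point with one fixed nonzero vector u shows that the scalar is
the same everywhere.

To see that a half-derivation d is a scalar, let u be the first basis vector,
so that u u = - u.  The defining identity on the pair (u, u) makes d u an
eigenvector, for the eigenvalue -2, of x |-> u x + x u; this eigenspace is the
line through u in all three algebras.  Subtracting a scalar from d, which
preserves half-derivations, one may assume d u = 0.  Then
u (d v) = 2 d (u v), and since left multiplication by u is diagonal in the given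
basis with integer eigenvalues (weights), d maps the space of weight m into
the space of weight 2 m ([half_derivation_weight]).  The weights are -2, -1, 0,
1 in W(2) and W_2, and -3, -1, 1, 3 in S_2: in characteristic zero this kills d
on every basis vector of S_2, and on every basis vector of the other two except
those of weight 0 and -1.  Weight -1 is settled by multiplying by u on the
right; weight 0 is settled by a vector of weight -2 (e_5, respectively xi_4),
whose left multiplication is injective on weight 0 and maps it into weight -1,
where d vanishes already. *)

(** * Half-derivations of an arbitrary algebra *)

Section BilinearProduct.
Context {K : fieldType} {A : lmodType K} {mul : A -> A -> A}.
Hypothesis two_neq0 : (2 : K) != 0.
Hypothesis mul_linearl : forall y, linear (mul^~ y).
Hypothesis mul_linearr : forall x, linear (mul x).
Implicit Types (d : A -> A) (c : K) (x y u v : A).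

Lemma half_derivation_morph d : half_derivation mul d ->
  [/\ d 0 = 0, {morph d : x y / x + y}, {morph d : x / - x}
    & forall c, {morph d : x / c *: x}].
Proof.
move=> [lin_d _].
have dD : {morph d : x y / x + y}.
  by move=> x y; have := lin_d 1 x y; rewrite !scale1r.
have d0 : d 0 = 0 by apply: (addrI (d 0)); rewrite -dD !addr0.
have dZ c : {morph d : x / c *: x}.
  by move=> x; have := lin_d c x 0; rewrite d0 !addr0.
by split=> // x; rewrite -!scaleN1r dZ.
Qed.

Lemma bilinear_mul0 x : mul x 0 = 0 /\ mul 0 x = 0.
Proof.
split.
  have := mul_linearr x 1 0 0; rewrite !scale1r addr0 => E.
  by apply: (addrI (mul x 0)); rewrite -E addr0.
have := mul_linearl x 1 0 0; rewrite !scale1r addr0 => E.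
by apply: (addrI (mul 0 x)); rewrite -E addr0.
Qed.

Lemma double_half_derivation d x y :
  half_derivation mul d -> 2 *: d (mul x y) = mul (d x) y + mul x (d y).
Proof. by move=> [_ ->]; rewrite scalerA divff // scale1r. Qed.

Lemma half_derivation_scale c : half_derivation mul (fun x => c *: x).
Proof.
split=> [a x y|x y]; first by rewrite scalerDr !scalerA mulrC.
have -> : mul (c *: x) y = c *: mul x y.
  have := mul_linearl y c x 0; rewrite !addr0 => ->.
  by have [_ ->] := bilinear_mul0 y; rewrite addr0.
have -> : mul x (c *: y) = c *: mul x y.
  have := mul_linearr x c y 0; rewrite !addr0 => ->.
  by have [-> _] := bilinear_mul0 x; rewrite addr0.
by rewrite -scalerDl scalerA -mulr2n -[c *+ 2]mulr_natl mulrA mulVf // mul1r.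
Qed.

Lemma half_derivation_subscale d c :
  half_derivation mul d -> half_derivation mul (fun x => d x - c *: x).
Proof.
move=> [lin_d d_mul]; have [_ c_mul] := half_derivation_scale c.
split=> [a x y|x y].
  by rewrite lin_d !scalerDr !opprD scalerN !scalerA addrACA [c * a]mulrC.
have mulBl z1 z2 w : mul (z1 - z2) w = mul z1 w - mul z2 w.
  by rewrite addrC -scaleN1r mul_linearl scaleN1r addrC.
have mulBr w z1 z2 : mul w (z1 - z2) = mul w z1 - mul w z2.
  by rewrite addrC -scaleN1r mul_linearr scaleN1r addrC.
by rewrite d_mul c_mul mulBl mulBr -scalerBr opprD addrACA.
Qed.

Lemma half_derivation_mull d u v :
  half_derivation mul d -> d u = 0 -> mul u (d v) = 2 *: d (mul u v).
Proof.
move=> hd du0; rewrite double_half_derivation // du0.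
by have [_ ->] := bilinear_mul0 v; rewrite add0r.
Qed.

Lemma half_derivation_mulr d u v :
  half_derivation mul d -> d u = 0 -> mul (d v) u = 2 *: d (mul v u).
Proof.
move=> hd du0; rewrite double_half_derivation // du0.
by have [-> _] := bilinear_mul0 v; rewrite addr0.
Qed.

(** Any pair (u, x) is moved by a common scalar; as u is nonzero, the scalar
can be read off from D u alone, hence does not depend on x. *)
Lemma two_local_of_scalar u (D : A -> A) :
    u != 0 ->
    (forall d, half_derivation mul d -> exists c, forall x, d x = c *: x) ->
  two_local_half_derivation mul D -> half_derivation mul D.
Proof.
move=> u_neq0 scal locD.
have [c Dc] : exists c, forall x, D x = c *: x.
  have [d [/scal [c dE] Du _]] := locD u u; exists c => x.
  have [d' [/scal [c' d'E] Du' ->]] := locD u x.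
  rewrite d'E; congr (_ *: _); apply/eqP; rewrite -subr_eq0.
  have /eqP : (c' - c) *: u = 0 by rewrite scalerBl -d'E -Du' Du dE subrr.
  by rewrite scaler_eq0 (negPf u_neq0) orbF.
have [lin_c c_mul] := half_derivation_scale c.
by split=> [a x y|x y]; rewrite !Dc ?lin_c ?c_mul.
Qed.

(** For a half-derivation d, evaluating d (u u) = - d u shows that x = d u
satisfies the equation of the third hypothesis.  So d u = c u, and d - c is a
half-derivation vanishing at u. *)
Lemma two_local_of_eigenline u (D : A -> A) :
    u != 0 -> mul u u = - u ->
    (forall x, mul u x + mul x u = - (2 *: x) -> exists c, x = c *: u) ->
    (forall d, half_derivation mul d -> d u = 0 -> forall x, d x = 0) ->
  two_local_half_derivation mul D -> half_derivation mul D.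
Proof.
move=> u_neq0 uu line rigid; apply: two_local_of_scalar u_neq0 _ => d hd.
have [_ _ dN _] := half_derivation_morph _ hd.
have [|c du] := line (d u).
  by rewrite addrC -double_half_derivation // uu dN scalerN.
exists c => x; apply/eqP; rewrite -subr_eq0; apply/eqP.
by apply: (rigid (fun x => d x - c *: x)) => //;
  [exact: half_derivation_subscale | rewrite du subrr].
Qed.

End BilinearProduct.

(** * Coordinates in an algebra given by a table *)

Section Coordinates.
Context {K : fieldType} {n : nat}.
Implicit Types (x y : 'rV[K]_n.+1) (t : nat -> nat -> 'rV[K]_n.+1).

(** Coordinates are numbered from 1, as the basis is. *)
Definition entry x (i : nat) : K := x 0 (inord i.-1).

Lemma entryD x y i : entry (x + y) i = entry x i + entry y i.
Proof. exact: mxE. Qed.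

Lemma entryN x i : entry (- x) i = - entry x i.
Proof. exact: mxE. Qed.

Lemma entryZ a x i : entry (a *: x) i = a * entry x i.
Proof. exact: mxE. Qed.

Lemma entry0 i : entry 0 i = 0.
Proof. exact: mxE. Qed.

Lemma entry_basis i j :
  (0 < i <= n.+1)%N -> (0 < j <= n.+1)%N -> entry (basis K n i) j = (i == j)%:R.
Proof.
move=> /andP[i0 iN] /andP[j0 jN]; rewrite /entry /basis mxE eqxx /=.
rewrite -val_eqE /= !inordK ?prednK // eq_sym; congr (_%:R).
by case: i j i0 j0 {iN jN} => [|i] [|j].
Qed.

Lemma entry_sum (I : Type) (r : seq I) (F : I -> 'rV[K]_n.+1) k :
  entry (\sum_(i <- r) F i) k = \sum_(i <- r) entry (F i) k.
Proof. exact: summxE. Qed.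

Lemma sum_ord1 (V : nmodType) (F : 'I_n.+1 -> V) :
  \sum_(i < n.+1) F i = \sum_(1 <= i < n.+2) F (inord i.-1).
Proof.
rewrite big_add1 /= big_mkord; apply: eq_bigr => i _.
by rewrite inord_val.
Qed.

Lemma entry_expand x : x = \sum_(1 <= i < n.+2) entry x i *: basis K n i.
Proof.
by rewrite {1}[x]row_sum_delta sum_ord1.
Qed.

Lemma entry_eq0 x :
  (forall i, (0 < i <= n.+1)%N -> entry x i = 0) -> x = 0.
Proof.
move=> x0; rewrite [x]entry_expand big_nat big1 // => i iN.
by rewrite x0 ?scale0r.
Qed.

Lemma mul_basisl t i x : (0 < i <= n.+1)%N ->
  table_mul t (basis K n i) x = \sum_(1 <= j < n.+2) entry x j *: t i j.
Proof.
move=> iN; rewrite /table_mul sum_ord1.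
rewrite (bigD1_seq i) ?mem_index_iota ?iota_uniq //=.
rewrite [X in _ + X]big1_seq => [|k /andP[ki]]; last first.
  rewrite mem_index_iota => kN; rewrite big1 // => j _.
  by rewrite -/(entry _ k) entry_basis // eq_sym (negPf ki) mul0r scale0r.
rewrite addr0 sum_ord1; apply: eq_big_nat => j /andP[j0 jN].
case/andP: (iN) => i0 i1.
by rewrite -!/(entry _ _) entry_basis // eqxx mul1r !inordK ?prednK.
Qed.

Lemma mul_basisr t i x : (0 < i <= n.+1)%N ->
  table_mul t x (basis K n i) = \sum_(1 <= j < n.+2) entry x j *: t j i.
Proof.
move=> iN; rewrite /table_mul sum_ord1; apply: eq_big_nat => j /andP[j0 jN].
rewrite sum_ord1 (bigD1_seq i) ?mem_index_iota ?iota_uniq //=.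
rewrite [X in _ + X]big1_seq => [|k /andP[ki]]; last first.
  rewrite mem_index_iota => kN.
  rewrite -!/(entry _ _) (entry_basis i k) // eq_sym (negPf ki).
  by rewrite mulr0 scale0r.
case/andP: (iN) => i0 i1.
by rewrite addr0 -!/(entry _ _) entry_basis // eqxx mulr1 !inordK ?prednK.
Qed.

Lemma mul_basis t i j : (0 < i <= n.+1)%N -> (0 < j <= n.+1)%N ->
  table_mul t (basis K n i) (basis K n j) = t i j.
Proof.
move=> iN jN; rewrite mul_basisl //.
rewrite (bigD1_seq j) ?mem_index_iota ?iota_uniq //=.
rewrite entry_basis // eqxx scale1r big1_seq ?addr0 // => k /andP[kj].
rewrite mem_index_iota => kN.
by rewrite entry_basis // eq_sym (negPf kj) scale0r.
Qed.

Lemma basis_neq0 i : (0 < i <= n.+1)%N -> basis K n i != 0.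
Proof.
move=> iN; apply/eqP => /(congr1 (entry^~ i)) /eqP.
by rewrite entry_basis // entry0 eqxx oner_eq0.
Qed.

Lemma entry_eq_scale_basis x i : (0 < i <= n.+1)%N ->
    (forall k, (0 < k <= n.+1)%N -> k != i -> entry x k = 0) ->
  x = entry x i *: basis K n i.
Proof.
move=> iN x0; rewrite {1}[x]entry_expand.
rewrite (bigD1_seq i) ?mem_index_iota ?iota_uniq //=.
rewrite big1_seq ?addr0 // => k /andP[ki]; rewrite mem_index_iota => kN.
by rewrite x0 ?scale0r.
Qed.

Lemma linear_basis_eq0 (d : 'rV[K]_n.+1 -> 'rV[K]_n.+1) :
    linear d -> d 0 = 0 ->
    (forall i, (0 < i <= n.+1)%N -> d (basis K n i) = 0) ->
  forall x, d x = 0.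
Proof.
move=> lin_d d0 db x; rewrite [x]entry_expand big_nat.
elim/big_rec: _ => // i y iN dy.
by rewrite lin_d db // scaler0 dy addr0.
Qed.

End Coordinates.

(** * Weights of the first basis vector *)

Section Weights.
Context {K : fieldType} {n : nat}.
Hypothesis charK0 : [pchar K] =i pred0.

Lemma intr_neq0 (m : int) : m != 0 -> m%:~R != 0 :> K.
Proof.
have nat_neq0 k : k.+1%:R != 0 :> K by have /pcharf0P -> := charK0.
by case: m => [[|k]|k] // _; rewrite ?NegzE ?mulrNz ?oppr_eq0 -pmulrn nat_neq0.
Qed.

Lemma int_cancel (m : int) (a b x : K) :
  a = b -> m != 0 -> m%:~R * x = a - b -> x = 0.
Proof.
move=> -> /intr_neq0 m_neq0 /eqP; rewrite subrr mulf_eq0 (negPf m_neq0).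
by move/eqP.
Qed.

Lemma nat_cancel (m : nat) (a b x : K) :
  a = b -> m != 0%N -> m%:R * x = a - b -> x = 0.
Proof. exact: (int_cancel m). Qed.

(** Since u (d v) = 2 d (u v), a vector v of weight m is sent by d to one of
weight 2 m. *)
Lemma half_derivation_weight (t : nat -> nat -> 'rV[K]_n.+1) (w : nat -> int) d :
    (forall i, (0 < i <= n.+1)%N -> t 1%N i = (w i)%:~R *: basis K n i) ->
    half_derivation (table_mul t) d -> d (basis K n 1) = 0 ->
  forall i k, (0 < i <= n.+1)%N -> (0 < k <= n.+1)%N -> w k != 2 * w i ->
  entry (d (basis K n i)) k = 0.
Proof.
move=> diag hd du0 i k iN kN wki.
have two_neq0 : (2 : K) != 0 by apply: (intr_neq0 2).
have E := half_derivation_mull two_neq0 (table_mul_linearl t)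
  (table_mul_linearr t) d _ (basis K n i) hd du0.
move/(congr1 (entry^~ k)): E; rewrite mul_basis // diag //.
have [_ _ _ dZ] := half_derivation_morph _ hd; rewrite dZ.
rewrite mul_basisl // entry_sum (bigD1_seq k) ?mem_index_iota ?iota_uniq //=.
rewrite big1_seq => [|j /andP[jk]]; last first.
  rewrite mem_index_iota => jN.
  by rewrite diag // !entryZ entry_basis // (negPf jk) !mulr0.
rewrite diag // !entryZ entry_basis // eqxx addr0 mulr1 => E.
apply: (int_cancel (w k - 2 * w i) _ _ _ E); first by rewrite subr_eq0.
by rewrite intrB intrM; ring.
Qed.

(** The form of [two_local_of_eigenline] that finitely many coordinate
computations can check. *)
Lemma table_two_local (t : nat -> nat -> 'rV[K]_n.+1) D :
    t 1%N 1%N = - basis K n 1 ->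
    (forall x, table_mul t (basis K n 1) x + table_mul t x (basis K n 1) =
        - (2 *: x) ->
      forall k, (1 < k <= n.+1)%N -> entry x k = 0) ->
    (forall d, half_derivation (table_mul t) d -> d (basis K n 1) = 0 ->
      forall i, (1 < i <= n.+1)%N -> d (basis K n i) = 0) ->
  two_local_half_derivation (table_mul t) D -> half_derivation (table_mul t) D.
Proof.
move=> t11 line rigid; apply: (two_local_of_eigenline _ _ _ (basis K n 1)).
- exact: (intr_neq0 2).
- exact: table_mul_linearl.
- exact: table_mul_linearr.
- exact: basis_neq0.
- by rewrite mul_basis.
- move=> x /line x0; exists (entry x 1); apply: entry_eq_scale_basis => // k.
  by case: k => [|[|k]] // kN _; apply: x0.
- move=> d hd du0; have [lin_d _] := hd.
  have [d0 _ _ _] := half_derivation_morph _ hd.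
  apply: linear_basis_eq0 => // -[|[|i]] // iN; exact: rigid.
Qed.

End Weights.

(** * The three algebras *)

(* Turns the coordinates of a product with a basis vector into an explicit
   polynomial expression in the coordinates of the other factor. *)
Ltac expand_entry :=
  rewrite ?mul_basisl ?mul_basisr // /index_iota ?subn1 /= ?big_cons ?big_nil /=
    ?(entry_basis, entryD, entryN, entryZ, entry0) //=
    ?(mulr0, oppr0, addr0, add0r).

(* From E : a = b, conclude that a coordinate x_i is zero, given a linear form f
   and a nonzero numeral m such that m x_i = f a - f b. *)
Ltac read_form charK0 E f m :=
  apply: (nat_cancel charK0 m%N _ _ _ (congr1 f E));
  [by [] | rewrite /=; expand_entry; ring].

Ltac read_entry charK0 E k m :=
  match type of E with @eq ?T _ _ =>
    read_form charK0 E (fun z : T => entry z k) m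
  end.

Section ThreeAlgebras.
Context {K : fieldType} (charK0 : [pchar K] =i pred0).

Let two_neq0 : (2 : K) != 0 := intr_neq0 charK0 2 isT.

(** The weights are -1, 1, 3, -3, and no weight is twice another one: a
half-derivation vanishing at z_1 vanishes. *)
Lemma trace_zero_two_local (D : 'rV[K]_4 -> 'rV[K]_4) :
  two_local_half_derivation (@trace_zero_mul K) D ->
  half_derivation (@trace_zero_mul K) D.
Proof.
apply: (table_two_local charK0) => //.
  move=> x E [|[|[|[|[|k]]]]] // _.
  - read_entry charK0 E 2%N 1%N.
  - read_entry charK0 E 3%N 5%N.
  - read_entry charK0 E 4%N 2%N.
move=> d hd du0 i iN; apply: entry_eq0 => k kN.
apply: (half_derivation_weight charK0 (@trace_zero_table K)
  (fun j => nth 0 [:: -1; 1; 3; -3] j.-1) d _ hd du0) => //.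
- by case=> [|[|[|[|[|j]]]]] //= _; rewrite ?mulrNz ?scaleNr ?scale1r.
- by case/andP: iN => /ltnW ->.
- by case: i k iN kN => [|[|[|[|[|i]]]]] // [|[|[|[|[|k]]]]].
Qed.

(** The weight -1 vector xi_5 is sent to a multiple of xi_4, which vanishes
because xi_5 xi_1 = 0 whereas xi_4 xi_1 = xi_4.  The weight 0 vectors xi_2 and
xi_6 are sent to their span, where xi_4 detects that the image is zero. *)
Lemma terminal_two_local (D : 'rV[K]_6 -> 'rV[K]_6) :
  two_local_half_derivation (@terminal_mul K) D ->
  half_derivation (@terminal_mul K) D.
Proof.
apply: (table_two_local charK0) => //.
  move=> x E [|[|[|[|[|[|[|k]]]]]]] // _.
  - read_entry charK0 E 2%N 1%N.
  - read_entry charK0 E 3%N 3%N.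
  - read_entry charK0 E 4%N 1%N.
  - read_entry charK0 E 5%N 1%N.
  - read_entry charK0 E 6%N 2%N.
move=> d hd du0.
have mull := half_derivation_mull two_neq0 (table_mul_linearl _)
  (table_mul_linearr _) d _ _ hd.
have mulr := half_derivation_mulr two_neq0 (table_mul_linearl _)
  (table_mul_linearr _) d _ _ hd.
have [d0 dD dN dZ] := half_derivation_morph _ hd.
pose w j : int := nth 0 [:: -1; 0; 1; -2; -1; 0] j.-1.
have W i k : (0 < i <= 6)%N -> (0 < k <= 6)%N -> w k != 2 * w i ->
    entry (d (basis K 5 i)) k = 0.
  apply: (half_derivation_weight charK0 _ w d _ hd du0).
  by case=> [|[|[|[|[|[|[|j]]]]]]] //= _;
    rewrite ?mulrNz ?scaleNr ?scale1r ?scale0r ?oppr0.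
have d4 : d (basis K 5 4) = 0.
  by apply: entry_eq0 => -[|[|[|[|[|[|[|k]]]]]]] // kN; apply: W.
have d5 : d (basis K 5 5) = 0.
  apply: entry_eq0 => -[|[|[|[|[|[|[|k]]]]]]] // kN; try exact: W.
  have E := mulr _ (basis K 5 5) du0; rewrite mul_basis //= d0 in E.
  by read_entry charK0 E 4%N 1%N.
(* Left multiplication by xi_4 is injective on the span of xi_2 and xi_6. *)
have weight0 v : d (table_mul (@terminal_table K) (basis K 5 4) v) = 0 ->
    (forall k, k \in [:: 1; 3; 4; 5]%N -> entry (d v) k = 0) -> d v = 0.
  move=> d4v x0; have := mull _ v d4; rewrite {}d4v => E.
  apply: entry_eq0 => -[|[|[|[|[|[|[|k]]]]]]] // _; try exact: x0.
  - read_form charK0 E (fun z : 'rV[K]_6 => - entry z 1%N) 2%N.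
  - read_form charK0 E (fun z : 'rV[K]_6 =>
      - (2 * entry z 5%N + entry z 1%N)) 2%N.
case=> [|[|[|[|[|[|[|j]]]]]]] // _.
- apply: weight0; last by case=> [|[|[|[|[|[|[|k]]]]]]] // _; apply: W.
  by rewrite mul_basis //= dD dN dZ d5 du0 scaler0 subr0.
- by apply: entry_eq0 => -[|[|[|[|[|[|[|k]]]]]]] // kN; apply: W.
- apply: weight0; last by case=> [|[|[|[|[|[|[|k]]]]]]] // _; apply: W.
  by rewrite mul_basis //= dN d5 oppr0.
Qed.

(** The weight -1 vectors e_6 and e_7 are sent to multiples of e_5, which vanish
because e_6 e_1 = e_7 e_1 = 0 whereas e_5 e_1 = e_5.  The weight 0 vectors e_2,
e_3 and e_8 are sent to their span, where e_5 detects that the image is zero. *)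
Lemma conservative_two_local (D : 'rV[K]_8 -> 'rV[K]_8) :
  two_local_half_derivation (@conservative_mul K) D ->
  half_derivation (@conservative_mul K) D.
Proof.
apply: (table_two_local charK0) => //.
  move=> x E [|[|[|[|[|[|[|[|[|k]]]]]]]]] // _.
  - read_entry charK0 E 2%N 1%N.
  (* Right multiplication by e_1 sends e_2 to - e_2 - e_3. *)
  - read_form charK0 E (fun z : 'rV[K]_8 =>
      entry z 3%N + entry z 2%N) 2%N.
  - read_entry charK0 E 4%N 3%N.
  - read_entry charK0 E 5%N 1%N.
  - read_entry charK0 E 6%N 1%N.
  - read_entry charK0 E 7%N 1%N.
  - read_entry charK0 E 8%N 2%N.
move=> d hd du0.
have mull := half_derivation_mull two_neq0 (table_mul_linearl _)
  (table_mul_linearr _) d _ _ hd.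
have mulr := half_derivation_mulr two_neq0 (table_mul_linearl _)
  (table_mul_linearr _) d _ _ hd.
have [d0 dD dN dZ] := half_derivation_morph _ hd.
pose w j : int := nth 0 [:: -1; 0; 0; 1; -2; -1; -1; 0] j.-1.
have W i k : (0 < i <= 8)%N -> (0 < k <= 8)%N -> w k != 2 * w i ->
    entry (d (basis K 7 i)) k = 0.
  apply: (half_derivation_weight charK0 _ w d _ hd du0).
  by case=> [|[|[|[|[|[|[|[|[|j]]]]]]]]] //= _;
    rewrite ?mulrNz ?scaleNr ?scale1r ?scale0r ?oppr0.
have d5 : d (basis K 7 5) = 0.
  by apply: entry_eq0 => -[|[|[|[|[|[|[|[|[|k]]]]]]]]] // kN; apply: W.
have d6 : d (basis K 7 6) = 0.
  apply: entry_eq0 => -[|[|[|[|[|[|[|[|[|k]]]]]]]]] // kN; try exact: W.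
  have E := mulr _ (basis K 7 6) du0; rewrite mul_basis //= d0 in E.
  read_entry charK0 E 5%N 1%N.
have d7 : d (basis K 7 7) = 0.
  apply: entry_eq0 => -[|[|[|[|[|[|[|[|[|k]]]]]]]]] // kN; try exact: W.
  have E := mulr _ (basis K 7 7) du0; rewrite mul_basis //= d0 in E.
  read_entry charK0 E 5%N 1%N.
(* Left multiplication by e_5 is injective on the span of e_2, e_3 and e_8. *)
have weight0 v : d (table_mul (@conservative_table K) (basis K 7 5) v) = 0 ->
    (forall k, k \in [:: 1; 4; 5; 6; 7]%N -> entry (d v) k = 0) -> d v = 0.
  move=> d5v x0; have := mull _ v d5; rewrite {}d5v => E.
  apply: entry_eq0 => -[|[|[|[|[|[|[|[|[|k]]]]]]]]] // _; try exact: x0.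
  - read_form charK0 E (fun z : 'rV[K]_8 =>
      entry z 6%N - entry z 7%N - entry z 1%N) 2%N.
  - read_form charK0 E (fun z : 'rV[K]_8 =>
      entry z 7%N - entry z 6%N - entry z 1%N) 2%N.
  - read_form charK0 E (fun z : 'rV[K]_8 =>
      - (entry z 1%N + entry z 6%N + entry z 7%N)) 2%N.
case=> [|[|[|[|[|[|[|[|[|j]]]]]]]]] // _.
- apply: weight0; last by case=> [|[|[|[|[|[|[|[|[|k]]]]]]]]] // _; apply: W.
  by rewrite mul_basis //= dD dN d6 du0 oppr0 addr0.
- apply: weight0; last by case=> [|[|[|[|[|[|[|[|[|k]]]]]]]]] // _; apply: W.
  by rewrite mul_basis //= dD dN d7 du0 oppr0 addr0.
- by apply: entry_eq0 => -[|[|[|[|[|[|[|[|[|k]]]]]]]]] // kN; apply: W.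
- apply: weight0; last by case=> [|[|[|[|[|[|[|[|[|k]]]]]]]]] // _; apply: W.
  by rewrite mul_basis //= dD !dN d6 d7 oppr0 addr0.
Qed.

End ThreeAlgebras.

Theorem theorem1p3 (K : fieldType) (charK0 : [pchar K] =i pred0) :
  [/\ forall D : 'rV[K]_8 -> 'rV[K]_8,
        two_local_half_derivation (@conservative_mul K) D ->
        half_derivation (@conservative_mul K) D,
      forall D : 'rV[K]_6 -> 'rV[K]_6,
        two_local_half_derivation (@terminal_mul K) D ->
        half_derivation (@terminal_mul K) D
    & forall D : 'rV[K]_4 -> 'rV[K]_4,
        two_local_half_derivation (@trace_zero_mul K) D ->
        half_derivation (@trace_zero_mul K) D].
Proof.
split=> D.
- exact: conservative_two_local.
- exact: terminal_two_local.
- exact: trace_zero_two_local.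
Qed.
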